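(* The quantum hockey-stick divergence $E_\gamma$ has the following properties. (Triangle inequality) For $\gamma_1,\gamma_2\ge1$ and positive semidefinite $\rho,\sigma,\tau$ on the same space, $$E_{\gamma_1\gamma_2}(\rho\|\sigma)\le E_{\gamma_1}(\rho\|\tau)+\gamma_1E_{\gamma_2}(\tau\|\sigma).$$ (Strong convexity) Let $\gamma_1,\gamma_2\ge1$, let $p,q$ be probability distributions on a finite set, let $\rho_x,\sigma_x$ be positive semidefinite operators, and set $\rho=\sum_xp(x)\rho_x$, $\sigma=\sum_xq(x)\sigma_x$. Then $$E_{\gamma_1\gamma_2}(\rho\|\sigma)\le\sum_xp(x)E_{\gamma_1}(\rho_x\|\sigma_x)+\gamma_1E_{\gamma_2}(\tilde p\|\tilde q),$$ where $\tilde p$ and $\tilde q$ are the non-normalized distributions $\tilde p(x)=p(x)\operatorname{Tr}\sigma_x$ and $\tilde q(x)=q(x)\operatorname{Tr}\sigma_x$. This also implies convexity and joint convexity of $E_\gamma$. (Stability) For $\gamma\ge1$ and positive semidefinite $\rho,\sigma$ on one space and $\tau\ne0$ positive semidefinite on a second tensor factor, $$E_\gamma(\rho\otimes\tau\|\sigma\otimes\tau)=\operatorname{Tr}[\tau]\,E_\gamma(\rho\|\sigma).$$ (Subadditivity) For $\gamma_1,\gamma_2\ge1$, positive semidefinite $\rho_1,\sigma_1$ on $\mathcal{H}_1$ and positive semidefinite $\rho_2,\sigma_2$ on $\mathcal{H}_2$, $$E_{\gamma_1\gamma_2}(\rho_1\otimes\rho_2\|\sigma_1\otimes\sigma_2)\le\operatorname{Tr}[\rho_2]E_{\gamma_1}(\rho_1\|\sigma_1)+\operatorname{Tr}[\sigma_1]\gamma_1E_{\gamma_2}(\rho_2\|\sigma_2),$$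 $$E_{\gamma_1\gamma_2}(\rho_1\otimes\rho_2\|\sigma_1\otimes\sigma_2)\le\operatorname{Tr}[\rho_1]E_{\gamma_1}(\rho_2\|\sigma_2)+\operatorname{Tr}[\sigma_2]\gamma_1E_{\gamma_2}(\rho_1\|\sigma_1).$$ (Symmetry) For $\gamma\ge1$ and positive semidefinite $\rho,\sigma$ on the same space, $$E_\gamma(\rho\|\sigma)=\gamma E_{1/\gamma}(\sigma\|\rho)+\big(\operatorname{Tr}(\rho)-\gamma\operatorname{Tr}(\sigma)\big).$$ (Trace bound) For $\gamma\ge1$ and positive semidefinite $\rho,\sigma,\tau$ on the same space, $$E_\gamma(\rho\|\sigma)+E_\gamma(\rho\|\tau)\ge\frac{\gamma}{2}\|\tau-\sigma\|_1+\big(\operatorname{Tr}(\rho)-\gamma\operatorname{Tr}(\tau)\big).$$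
   Context: All Hilbert spaces are finite-dimensional and complex. For a Hermitian operator $X$, $X^+$ denotes the positive part in its decomposition $X=X^+-X^-$ into positive and negative parts (from the eigendecomposition), and $\|X\|_1=\operatorname{Tr}|X|$ is the trace norm. For positive semidefinite operators $\rho,\sigma$ on the same space and $\gamma\ge1$, the quantum hockey-stick divergence is $E_\gamma(\rho\|\sigma)=\operatorname{Tr}(\rho-\gamma\sigma)^+$; the quantity $E_{1/\gamma}$ in the symmetry item is given by the same formula with $1/\gamma$ in place of $\gamma$. For nonnegative functions $\tilde p,\tilde q$ on a finite set, $E_\gamma(\tilde p\|\tilde q)=\sum_x\max\{0,\tilde p(x)-\gamma\tilde q(x)\}$, i.e. the same quantity for the corresponding diagonal operators.
   Formalization: The trace bound is proved under the added assumption Tr(σ) ≤ Tr(τ); as stated it is false, e.g. in dimension 1 with γ=1, ρ=σ=1, τ=0 the left side is 1 and the right side is 3/2. *)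

(* Defs.v *)
From HB Require Import structures.
From mathcomp Require Import all_boot all_order all_algebra.
From mathcomp Require Import spectral sesquilinear.
From mathcomp Require Import complex mxtens.
From mathcomp Require Import reals.

Set Implicit Arguments.
Unset Strict Implicit.
Unset Printing Implicit Defensive.

Import Order.TTheory GRing.Theory Num.Theory.
Local Open Scope ring_scope.
Local Open Scope complex_scope.
Local Open Scope sesquilinear_scope.

Definition psdmx (R : realType) (n : nat) (A : 'M[R[i]]_n) : Prop :=
  A \is hermsymmx /\ forall u : 'cV[R[i]]_n, 0 <= (u ^t* *m A *m u) 0 0.

(* The trace as a real number; only used on Hermitian matrices, whose trace
   has no imaginary part. *)
Definition Tr (R : realType) (n : nat) (A : 'M[R[i]]_n) : R :=
  complex.Re (\tr A).

(* Functional calculus: for Hermitian X (which is diagonalised by the unitary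
   matrix spectralmx X, with real eigenvalues spectral_diag X), apply f to the
   eigenvalues. *)
Definition hermfun (R : realType) (f : R -> R) (n : nat) (X : 'M[R[i]]_n)
    : 'M[R[i]]_n :=
  invmx (spectralmx X)
    *m diag_mx (map_mx (fun z => (f (complex.Re z))%:C) (spectral_diag X))
    *m spectralmx X.

Definition pospart (R : realType) (n : nat) (X : 'M[R[i]]_n) :=
  hermfun (fun x : R => Num.max 0 x) X.

Definition negpart (R : realType) (n : nat) (X : 'M[R[i]]_n) :=
  hermfun (fun x : R => Num.max 0 (- x)) X.

Definition absmx (R : realType) (n : nat) (X : 'M[R[i]]_n) :=
  hermfun (fun x : R => `|x|) X.

Definition trnorm (R : realType) (n : nat) (X : 'M[R[i]]_n) : R :=
  Tr (absmx X).

Definition hockey (R : realType) (n : nat) (gamma : R) (rho sigma : 'M[R[i]]_n)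
    : R :=
  Tr (pospart (rho - gamma%:C *: sigma)).

Definition chockey (R : realType) (I : finType) (gamma : R) (p q : I -> R) : R :=
  \sum_x Num.max 0 (p x - gamma * q x).

Definition pdistr (R : realType) (I : finType) (p : I -> R) : Prop :=
  (forall x, 0 <= p x) /\ \sum_x p x = 1.

Lemma pospart_negpart (R : realType) (n : nat) (X : 'M[R[i]]_n) :
  X \is hermsymmx -> X = pospart X - negpart X.
Proof.
move=> hX; have /orthomx_spectralP eX := hermitian_normalmx hX.
have /mxOverP rX := hermitian_spectral_diag_real hX.
rewrite [LHS]eX /pospart /negpart /hermfun -mulmxBl -mulmxBr -raddfB /=.
congr (_ *m diag_mx _ *m _); apply/matrixP => i j; rewrite !mxE.
rewrite -[LHS]RRe_real ?rX // -rmorphB /=; congr (_%:C).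
set x := complex.Re _.
have [x0|x0] := leP 0 x.
  by rewrite max_l ?subr0 // oppr_le0.
by rewrite max_r ?sub0r ?opprK // oppr_ge0 ltW.
Qed.

Lemma Tr_hermfun_scalar (R : realType) (f : R -> R) (a : R) :
  Tr (hermfun f (a%:C%:M : 'M[R[i]]_1)) = f a.
Proof.
set X : 'M[R[i]]_1 := _%:M.
have hX : X \is hermsymmx.
  apply/is_hermitianmxP; rewrite expr0 scale1r.
  apply/matrixP => i j; rewrite !mxE !ord1 /= mulr1n.
  by apply/eqP; rewrite eq_complex /= oppr0 !eqxx.
have U := unitarymx_unit (spectral_unitarymx X).
have tr1 (d : 'rV[R[i]]_1) :
  \tr (invmx (spectralmx X) *m diag_mx d *m spectralmx X) = d 0 0.
  by rewrite mxtrace_mulC mulmxA mulmxV // mul1mx mxtrace_diag big_ord1.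
rewrite /Tr /hermfun tr1 mxE /=; congr f.
have /orthomx_spectralP eX := hermitian_normalmx hX.
by have := tr1 (spectral_diag X); rewrite -eX mxtrace_scalar mulr1n => <-.
Qed.

Lemma psdmx_scalar (R : realType) (a : R) :
  0 <= a -> psdmx (a%:C%:M : 'M[R[i]]_1).
Proof.
move=> a0; split.
  apply/is_hermitianmxP; rewrite expr0 scale1r.
  apply/matrixP => i j; rewrite !mxE !ord1 /= mulr1n.
  by apply/eqP; rewrite eq_complex /= oppr0 !eqxx.
move=> u; rewrite -mulmxA mul_scalar_mx -scalemxAr mxE mulr_ge0 ?ler0c //.
by rewrite !mxE big_ord1 !mxE mulrC mul_conjC_ge0.
Qed.

(* The trace bound needs Tr sigma <= Tr tau (equality for states): on a
   one-dimensional space with rho = sigma = 1, tau = 0, gamma = 1, its left-hand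
   side is 1 and its right-hand side is 3/2. *)
Lemma trace_bound_needs_le (R : realType) :
  exists rho sigma tau : 'M[R[i]]_1,
    [/\ psdmx rho, psdmx sigma, psdmx tau &
      hockey 1 rho sigma + hockey 1 rho tau
      < 1 / 2 * trnorm (tau - sigma) + (Tr rho - 1 * Tr tau)].
Proof.
exists (1 : R)%:C%:M, (1 : R)%:C%:M, (0 : R)%:C%:M.
split; try by apply: psdmx_scalar.
have trC (a : R) : Tr (a%:C%:M : 'M[R[i]]_1) = a.
  by rewrite /Tr mxtrace_scalar mulr1n.
have E (a b : R) : hockey 1 (a%:C%:M : 'M_1) b%:C%:M = Num.max 0 (a - b).
  rewrite /hockey scale1r -raddfB -rmorphB /=; exact: Tr_hermfun_scalar.
rewrite !E !trC /trnorm -raddfB -rmorphB Tr_hermfun_scalar.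
rewrite subrr subr0 sub0r maxxx max_r ?ler01 // normrN normr1 mulr0 subr0 mulr1.
by rewrite ltr_leD ?divr_gt0.
Qed.

(* Main.v *)
(* The trace of the positive part of a Hermitian [X] is the minimum of [Tr Y]
   over all [Y >= 0] with [Y >= X]: in an eigenbasis of [X] every diagonal entry
   of such a [Y] dominates both [0] and the corresponding eigenvalue, and
   [Y = X^+] attains the bound. Hence [X |-> Tr X^+] is sublinear, which gives
   the triangle inequality and the convexity statements once
   [rho - gamma sigma] is split suitably. Tensor products with a positive
   semidefinite factor are computed in a product eigenbasis, and symmetry is
   [Tr X^+ = Tr (- X)^+ + Tr X]. The trace bound applies sublinearity to
   [gamma (tau - sigma) = (rho - gamma sigma) - (rho - gamma tau)]. *)
Require Import Defs.
From mathcomp Require Import all_boot all_order all_algebra.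
From mathcomp Require Import spectral sesquilinear.
From mathcomp Require Import complex mxtens.
From mathcomp Require Import reals.
From mathcomp Require Import lra.

Import Order.TTheory GRing.Theory Num.Theory.
Local Open Scope ring_scope.
Local Open Scope complex_scope.

Section TracePositivePart.
Local Set Implicit Arguments.
Local Unset Strict Implicit.
Local Open Scope sesquilinear_scope.
Context {R : realType}.

(** * Adjoints, Hermitian matrices and the cone of positive semidefinite matrices *)

Lemma hermsymmxP n (A : 'M[R[i]]_n) : reflect (A ^t* = A) (A \is hermsymmx).
Proof.
apply: (iffP (is_hermitianmxP _ _ _)); rewrite expr0 scale1r => /esym //.
Qed.

Lemma adjmxM m n p (A : 'M[R[i]]_(m, n)) (B : 'M[R[i]]_(n, p)) :
  (A *m B) ^t* = B ^t* *m A ^t*.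
Proof. by rewrite trmx_mul map_mxM. Qed.

Lemma adjmxK m n (A : 'M[R[i]]_(m, n)) : A ^t* ^t* = A.
Proof. by apply/matrixP => i j; rewrite !mxE conjCK. Qed.

Lemma hermsymmxD n (A B : 'M[R[i]]_n) :
  A \is hermsymmx -> B \is hermsymmx -> A + B \is hermsymmx.
Proof.
move=> /hermsymmxP hA /hermsymmxP hB; apply/hermsymmxP.
by rewrite !raddfD /= hA hB.
Qed.

Lemma hermsymmxZ n (a : R) (A : 'M[R[i]]_n) :
  A \is hermsymmx -> a%:C *: A \is hermsymmx.
Proof.
move=> /hermsymmxP hA; apply/hermsymmxP.
by rewrite linearZ /= map_mxZ hA; congr (_ *: _); apply: conjc_real.
Qed.

Lemma hermsymmxN n (A : 'M[R[i]]_n) : A \is hermsymmx -> - A \is hermsymmx.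
Proof. by move=> /hermsymmxP hA; apply/hermsymmxP; rewrite !raddfN /= hA. Qed.

Lemma hermsymmxB n (A B : 'M[R[i]]_n) :
  A \is hermsymmx -> B \is hermsymmx -> A - B \is hermsymmx.
Proof.
by move=> hA hB; apply: hermsymmxD hA (hermsymmxN hB).
Qed.

Lemma psdmx_herm n (A : 'M[R[i]]_n) : psdmx A -> A \is hermsymmx.
Proof. by case. Qed.

Lemma psdmxD n (A B : 'M[R[i]]_n) : psdmx A -> psdmx B -> psdmx (A + B).
Proof.
move=> [hA pA] [hB pB]; split; first exact: hermsymmxD.
by move=> u; rewrite mulmxDr mulmxDl mxE addr_ge0.
Qed.

Lemma psdmxZ n (a : R) (A : 'M[R[i]]_n) :
  0 <= a -> psdmx A -> psdmx (a%:C *: A).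
Proof.
move=> a0 [hA pA]; split; first exact: hermsymmxZ.
by move=> u; rewrite -scalemxAr -scalemxAl mxE mulr_ge0 // ler0c.
Qed.

Lemma psdmx0 n : psdmx (0 : 'M[R[i]]_n).
Proof.
split; first by apply/hermsymmxP; rewrite !raddf0.
by move=> u; rewrite mulmx0 mul0mx mxE.
Qed.

Lemma psdmx_congr n m (A : 'M[R[i]]_n) (W : 'M[R[i]]_(n, m)) :
  psdmx A -> psdmx (W ^t* *m A *m W).
Proof.
move=> [/hermsymmxP hA pA]; split.
  by apply/hermsymmxP; rewrite !adjmxM adjmxK hA mulmxA.
by move=> u; have := pA (W *m u); rewrite adjmxM !mulmxA.
Qed.

Lemma psdmx_diag n (d : 'rV[R]_n) :
  (forall k, 0 <= d 0 k) -> psdmx (diag_mx (map_mx (real_complex R) d)).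
Proof.
move=> d0; split.
  apply/hermsymmxP/matrixP => i j; rewrite !mxE.
  by rewrite [j == i]eq_sym; case: eqVneq => [->|_] /=;
    rewrite ?mulr1n ?mulr0n ?conjC0 //; apply: conjc_real.
move=> u; rewrite mxE sumr_ge0 // => k _.
rewrite mul_mx_diag !mxE mulrAC mulr_ge0 ?lecR // mulrC; exact: mul_conjC_ge0.
Qed.

(** The diagonal entry is the quadratic form of [A] at the [k]-th basis vector. *)
Lemma psdmx_diag_ge0 n (A : 'M[R[i]]_n) k : psdmx A -> 0 <= complex.Re (A k k).
Proof.
case=> _ /(_ (delta_mx k 0)).
have -> : (delta_mx k 0 : 'cV[R[i]]_n) ^t* = delta_mx 0 k.
  by apply/matrixP => i j; rewrite !mxE andbC; case: (_ && _);
    rewrite ?conjC1 ?conjC0.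
by rewrite -rowE -colE !mxE lecE => /andP[].
Qed.

(** * Real traces and unitary diagonalisation *)

Lemma TrE n (A : 'M[R[i]]_n) : Tr A = \sum_k complex.Re (A k k).
Proof. by rewrite /Tr /mxtrace raddf_sum. Qed.

Lemma TrD n (A B : 'M[R[i]]_n) : Tr (A + B) = Tr A + Tr B.
Proof. by rewrite /Tr !raddfD. Qed.

Lemma TrB n (A B : 'M[R[i]]_n) : Tr (A - B) = Tr A - Tr B.
Proof. by rewrite /Tr !raddfB. Qed.

Lemma TrZ n (a : R) (A : 'M[R[i]]_n) : Tr (a%:C *: A) = a * Tr A.
Proof. by rewrite /Tr linearZ /=; case: (\tr A) => x y /=; rewrite mul0r subr0. Qed.

Lemma Tr_psdmx_ge0 n (A : 'M[R[i]]_n) : psdmx A -> 0 <= Tr A.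
Proof. by move=> pA; rewrite TrE sumr_ge0 // => k _; apply: psdmx_diag_ge0. Qed.

Lemma Tr_unitary_conj n (W A : 'M[R[i]]_n) :
  W \is unitarymx -> Tr (W *m A *m W ^t*) = Tr A.
Proof.
by move=> uW; rewrite /Tr -mulmxA mxtrace_mulC mulmxKtV.
Qed.

(** For unitary [W], the real row [d] lists the eigenvalues, so that order and [Num.max] apply to
    them directly. Any diagonalising basis may serve as [W], not just the one chosen by
    [spectralmx]; rescaled matrices and tensor products need this freedom. *)
Definition udiag n (W : 'M[R[i]]_n) (d : 'rV[R]_n) : 'M[R[i]]_n :=
  W ^t* *m diag_mx (map_mx (real_complex R) d) *m W.

Lemma udiag_conj n (W : 'M[R[i]]_n) (d : 'rV[R]_n) :
  W \is unitarymx ->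
  W *m udiag W d *m W ^t* = diag_mx (map_mx (real_complex R) d).
Proof.
by move=> uW; rewrite /udiag !mulmxA (unitarymxP uW) mul1mx mulmxtVK.
Qed.

Lemma udiagB n (W : 'M[R[i]]_n) (d e : 'rV[R]_n) :
  udiag W d - udiag W e = udiag W (d - e).
Proof. by rewrite /udiag -mulmxBl -mulmxBr -raddfB -map_mxB. Qed.

Lemma udiagZ n (W : 'M[R[i]]_n) (a : R) (d : 'rV[R]_n) :
  a%:C *: udiag W d = udiag W (a *: d).
Proof. by rewrite /udiag map_mxZ linearZ -scalemxAr -scalemxAl. Qed.

Lemma psdmx_udiag n (W : 'M[R[i]]_n) (d : 'rV[R]_n) :
  (forall k, 0 <= d 0 k) -> psdmx (udiag W d).
Proof. by move=> d0; apply/psdmx_congr/psdmx_diag. Qed.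

Lemma Tr_udiag n (W : 'M[R[i]]_n) (d : 'rV[R]_n) :
  W \is unitarymx -> Tr (udiag W d) = \sum_k d 0 k.
Proof.
move=> uW; rewrite -(Tr_unitary_conj _ uW) udiag_conj // TrE.
by apply: eq_bigr => k _; rewrite !mxE eqxx mulr1n.
Qed.

Lemma hermfunE (f : R -> R) n (X : 'M[R[i]]_n) :
  hermfun f X = udiag (spectralmx X)
                  (map_mx (fun z => f (complex.Re z)) (spectral_diag X)).
Proof.
by rewrite /hermfun /udiag (invmx_unitary (spectral_unitarymx X)) -map_mx_comp.
Qed.

Lemma Tr_hermfun (f : R -> R) n (X : 'M[R[i]]_n) :
  Tr (hermfun f X) = \sum_k f (complex.Re (spectral_diag X 0 k)).
Proof.
rewrite hermfunE Tr_udiag ?spectral_unitarymx //.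
by apply: eq_bigr => k _; rewrite mxE.
Qed.

Lemma hermfun_id n (X : 'M[R[i]]_n) : X \is hermsymmx -> hermfun id X = X.
Proof.
move=> hX; have /mxOverP rX := hermitian_spectral_diag_real hX.
rewrite /hermfun; have -> : map_mx (fun z => (id (complex.Re z))%:C)
    (spectral_diag X) = spectral_diag X.
  by apply/matrixP => i j; rewrite mxE RRe_real ?rX.
by have /orthomx_spectralP <- := hermitian_normalmx hX.
Qed.

Local Opaque hermfun.

Lemma hermsymmx_udiag n (X : 'M[R[i]]_n) : X \is hermsymmx ->
  exists2 W, W \is unitarymx & exists d, X = udiag W d.
Proof.
move=> hX; exists (spectralmx X); first exact: spectral_unitarymx.
by eexists; rewrite -{1}(hermfun_id hX) hermfunE.
Qed.

(** * The positive part and the sublinearity of its trace *)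

Lemma psdmx_pospart n (X : 'M[R[i]]_n) : psdmx (pospart X).
Proof.
by rewrite /pospart hermfunE; apply: psdmx_udiag => k; rewrite mxE le_max lexx.
Qed.

Lemma psdmx_negpart n (X : 'M[R[i]]_n) : psdmx (negpart X).
Proof.
by rewrite /negpart hermfunE; apply: psdmx_udiag => k; rewrite mxE le_max lexx.
Qed.

Lemma psdmx_pospartB n (X : 'M[R[i]]_n) :
  X \is hermsymmx -> psdmx (pospart X - X).
Proof.
move=> hX; rewrite {2}(pospart_negpart hX) opprB addrC subrK.
exact: psdmx_negpart.
Qed.

Definition Trpos n (X : 'M[R[i]]_n) : R := Tr (pospart X).

(* The case [Y = pospart X] bounds [Trpos X] below in an arbitrary orthonormal
   basis; an eigenbasis of [X] gives minimality over [Y]. *)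
Lemma psd_dominates_diag n (W X Y : 'M[R[i]]_n) :
  W \is unitarymx -> psdmx Y -> psdmx (Y - X) ->
  \sum_k Num.max 0 (complex.Re ((W *m X *m W ^t*) k k)) <= Tr Y.
Proof.
move=> uW pY pYX; rewrite -(Tr_unitary_conj Y uW) TrE.
apply: ler_sum => k _; rewrite ge_max.
have pos A : psdmx A -> 0 <= complex.Re ((W *m A *m W ^t*) k k).
  by move=> pA; apply: psdmx_diag_ge0; rewrite -{1}(adjmxK W);
    apply: psdmx_congr.
rewrite pos //= -subr_ge0 -raddfB /=.
by have := pos _ pYX; rewrite mulmxBr mulmxBl !mxE.
Qed.

Lemma TrposE n (X : 'M[R[i]]_n) :
  Trpos X = \sum_k Num.max 0 (complex.Re (spectral_diag X 0 k)).
Proof. exact: Tr_hermfun. Qed.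

Local Opaque Trpos.

(** In the eigenbasis of [X] the diagonal entries of [X] are its eigenvalues, so the bound of
    [psd_dominates_diag] becomes [Trpos X]. *)
Lemma Trpos_le n (X Y : 'M[R[i]]_n) :
  X \is hermsymmx -> psdmx Y -> psdmx (Y - X) -> Trpos X <= Tr Y.
Proof.
move=> hX pY pYX.
have uW := spectral_unitarymx X.
apply: le_trans (psd_dominates_diag uW pY pYX).
rewrite -{3}(hermfun_id hX) hermfunE (udiag_conj _ uW) TrposE.
by apply: ler_sum => k _; rewrite !mxE eqxx mulr1n.
Qed.

(** Frees [Trpos] from the particular basis [spectralmx]: eigenvalues may be read off from any
    unitary diagonalisation. *)
Lemma Trpos_udiag n (W : 'M[R[i]]_n) (d : 'rV[R]_n) :
  W \is unitarymx -> Trpos (udiag W d) = \sum_k Num.max 0 (d 0 k).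
Proof.
move=> uW; have hX : udiag W d \is hermsymmx.
  apply/hermsymmxP; rewrite /udiag !adjmxM adjmxK mulmxA tr_diag_mx map_diag_mx.
  have -> // : map_mx Num.conj (map_mx (real_complex R) d) =
      map_mx (real_complex R) d.
  by apply/matrixP => i j; rewrite !mxE; apply: conjc_real.
apply/eqP; rewrite eq_le; apply/andP; split.
  (* Upper bound: the matrix with eigenvalues $\max(0,d_k)$ in the basis [W] dominates both $0$ and
     $X$. *)
  have := @Trpos_le n _ (udiag W (map_mx (Num.max 0) d)) hX.
  rewrite udiagB Tr_udiag //.
  under eq_bigr do rewrite mxE.
  apply; apply: psdmx_udiag => k; rewrite !mxE ?subr_ge0 le_max lexx ?orbT //.
(* Lower bound: $Y=X^+$ is compared with $X$ in the basis [W], where $X$ has diagonal [d]. *)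
have := psd_dominates_diag uW (psdmx_pospart _) (psdmx_pospartB hX).
rewrite udiag_conj //.
by under eq_bigr do rewrite !mxE eqxx mulr1n.
Qed.

Lemma Trpos_psd n (X : 'M[R[i]]_n) : psdmx X -> Trpos X = Tr X.
Proof.
move=> pX; have hX := psdmx_herm pX; apply/eqP; rewrite eq_le.
apply/andP; split; first by apply: Trpos_le hX pX _; rewrite (subrr X);
  apply: psdmx0.
by rewrite -subr_ge0 -TrB; apply/Tr_psdmx_ge0/psdmx_pospartB.
Qed.

Lemma TrposZ n (a : R) (X : 'M[R[i]]_n) :
  0 <= a -> X \is hermsymmx -> Trpos (a%:C *: X) = a * Trpos X.
Proof.
move=> a0 /hermsymmx_udiag[W uW [d ->]].
rewrite udiagZ !(Trpos_udiag _ uW) mulr_sumr; apply: eq_bigr => k _.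
by rewrite mxE maxr_pMr // mulr0.
Qed.

(** The matrix $X^++Y^+$ is positive semidefinite and dominates $X+Y$, hence is a competitor in the
    minimum. *)
Lemma TrposD n (X Y : 'M[R[i]]_n) :
  X \is hermsymmx -> Y \is hermsymmx -> Trpos (X + Y) <= Trpos X + Trpos Y.
Proof.
move=> hX hY; rewrite -TrD; apply: Trpos_le; first exact: hermsymmxD.
  by apply: psdmxD; apply: psdmx_pospart.
by rewrite opprD addrACA; apply: psdmxD; apply: psdmx_pospartB.
Qed.

Lemma hermsymmx_sum n (I : finType) (X : I -> 'M[R[i]]_n) :
  (forall x, X x \is hermsymmx) -> \sum_x X x \is hermsymmx.
Proof.
move=> hX; elim/big_ind: _ => [|A B|x _]; last exact: hX.
  exact/psdmx_herm/psdmx0.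
exact: hermsymmxD.
Qed.

Lemma Trpos_sum n (I : finType) (X : I -> 'M[R[i]]_n) :
  (forall x, X x \is hermsymmx) -> Trpos (\sum_x X x) <= \sum_x Trpos (X x).
Proof.
move=> hX.
(* The induction carries Hermitianity of the partial sums along with the bound, since [TrposD] asks
   for it. *)
pose K (A : 'M[R[i]]_n) b := A \is hermsymmx /\ Trpos A <= b.
suff [] : K (\sum_x X x) (\sum_x Trpos (X x)) by [].
elim/big_ind2: _ => [|A a B b [hA leA] [hB leB]|x _]; last by split.
  by split; [apply/psdmx_herm/psdmx0 |];
    rewrite Trpos_psd ?/Tr ?raddf0 //; apply: psdmx0.
by split; [apply: hermsymmxD | apply: le_trans (TrposD hA hB) (lerD leA leB)].
Qed.

(** Eigenvalue by eigenvalue this is $\max(0,d)=\max(0,-d)+d$, as [W] diagonalises $X$ and $-X$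
    together. *)
Lemma TrposN n (X : 'M[R[i]]_n) :
  X \is hermsymmx -> Trpos X = Trpos (- X) + Tr X.
Proof.
move=> /hermsymmx_udiag[W uW [d ->]].
have -> : - udiag W d = udiag W (- d).
  by rewrite -scaleN1r -(rmorphN1 (real_complex R)) udiagZ scaleN1r.
rewrite !(Trpos_udiag _ uW) (Tr_udiag _ uW) -big_split; apply: eq_bigr => k _ /=.
by rewrite mxE; case: (leP 0 (d 0 k)) => h;
  [rewrite max_l ?add0r // oppr_le0|rewrite max_r ?addNr // oppr_ge0 ltW].
Qed.

(** For $a<0$ the matrix $-aA$ is positive semidefinite, so [TrposN] gives
    $\operatorname{Tr}(-aA)+\operatorname{Tr}(aA)=0$ on the left. *)
Lemma TrposZ_psd_le n (a : R) (A : 'M[R[i]]_n) :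
  psdmx A -> Trpos (a%:C *: A) <= Num.max 0 (a * Tr A).
Proof.
move=> pA; have [a0|a0] := leP 0 a.
  by rewrite TrposZ ?psdmx_herm // Trpos_psd // le_max lexx orbT.
rewrite TrposN ?hermsymmxZ ?psdmx_herm //.
have -> : - (a%:C *: A) = (- a)%:C *: A by rewrite rmorphN scaleNr.
rewrite Trpos_psd; last by apply: psdmxZ; rewrite ?oppr_ge0 ?ltW.
by rewrite !TrZ mulNr addNr le_max lexx.
Qed.

(** This is $|x|=2\max(0,x)-x$ summed over the eigenvalues. *)
Lemma trnormE n (X : 'M[R[i]]_n) :
  X \is hermsymmx -> trnorm X = 2 * Trpos X - Tr X.
Proof.
move=> hX; have eT : Tr X = \sum_k complex.Re (spectral_diag X 0 k).
  by rewrite -{1}(hermfun_id hX) Tr_hermfun.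
have -> : trnorm X = \sum_k `|complex.Re (spectral_diag X 0 k)|.
  exact: Tr_hermfun.
rewrite TrposE eT mulr_sumr -sumrB; apply: eq_bigr => k _.
set x := complex.Re _; have [x0|x0] := leP 0 x.
  by rewrite ger0_norm // mulr_natl mulr2n addrK.
by rewrite ltr0_norm // mulr0 sub0r.
Qed.

(** * Tensor products in a product eigenbasis *)

Lemma adjmx_tens m n p q (A : 'M[R[i]]_(m, n)) (B : 'M[R[i]]_(p, q)) :
  (tensmx A B) ^t* = tensmx (A ^t*) (B ^t*).
Proof. by rewrite trmx_tens map_mxT. Qed.

(** The eigenvalues are the products $d_ie_j$; [mxtens_unindex] recovers the pair $(i,j)$ from the
    flat index. *)
Lemma udiag_tens m n (V : 'M[R[i]]_m) (W : 'M[R[i]]_n) d e :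
  tensmx (udiag V d) (udiag W e) =
  udiag (tensmx V W)
    (\row_k (d 0 (mxtens_unindex k).1 * e 0 (mxtens_unindex k).2)).
Proof.
rewrite /udiag adjmx_tens -!tensmx_mul.
set D := tensmx (diag_mx _) _; set E := diag_mx _; have -> // : D = E.
apply/matrixP => i j.
case: (mxtens_indexP i) => i0 i1; case: (mxtens_indexP j) => j0 j1.
rewrite tensmxE !mxE !mxtens_indexK (can_eq (@mxtens_indexK _ _)) xpair_eqE /=.
case: eqVneq => [->|_]; last by rewrite mul0r.
case: eqVneq => [->|_]; last by rewrite mulr0.
by rewrite !mulr1n rmorphM.
Qed.

Lemma unitarymx_tens m n (V : 'M[R[i]]_m) (W : 'M[R[i]]_n) :
  V \is unitarymx -> W \is unitarymx -> tensmx V W \is unitarymx.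
Proof.
move=> /unitarymxP uV /unitarymxP uW; apply/unitarymxP.
rewrite adjmx_tens tensmx_mul uV uW; apply/matrixP => i j.
case: (mxtens_indexP i) => i0 i1; case: (mxtens_indexP j) => j0 j1.
by rewrite tensmxE !mxE (can_eq (@mxtens_indexK _ _)) xpair_eqE -natrM mulnb.
Qed.

Lemma hermsymmx_tens m n (A : 'M[R[i]]_m) (B : 'M[R[i]]_n) :
  A \is hermsymmx -> B \is hermsymmx -> tensmx A B \is hermsymmx.
Proof.
move=> /hermsymmxP hA /hermsymmxP hB; apply/hermsymmxP.
by rewrite adjmx_tens hA hB.
Qed.

Lemma Trpos_tens m n (V : 'M[R[i]]_m) (W : 'M[R[i]]_n) d e :
  V \is unitarymx -> W \is unitarymx ->
  Trpos (tensmx (udiag V d) (udiag W e)) =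
  \sum_i \sum_j Num.max 0 (d 0 i * e 0 j).
Proof.
move=> uV uW; rewrite udiag_tens Trpos_udiag ?unitarymx_tens //.
rewrite pair_big (reindex (@mxtens_index m n)).
  by apply: eq_bigr => ij _; rewrite mxE mxtens_indexK.
by exists (@mxtens_unindex m n) => k _; rewrite ?mxtens_indexK ?mxtens_unindexK.
Qed.

Lemma psdmx_diagonalize n (X : 'M[R[i]]_n) : psdmx X ->
  exists2 W, W \is unitarymx & exists2 d, X = udiag W d & forall k, 0 <= d 0 k.
Proof.
move=> pX; have [W uW [d eX]] := hermsymmx_udiag (psdmx_herm pX).
exists W => //; exists d => // k.
suff: psdmx (W *m X *m W ^t*).
  by move=> /(@psdmx_diag_ge0 _ _ k); rewrite eX udiag_conj // !mxE eqxx mulr1n.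
by rewrite -{1}(adjmxK W); apply: psdmx_congr.
Qed.

(** The eigenvalues $e_j\ge0$ of [A] factor out of $\max(0,d_ie_j)$, and they sum to its trace. *)
Lemma Trpos_tens_psdr m n (X : 'M[R[i]]_m) (A : 'M[R[i]]_n) :
  X \is hermsymmx -> psdmx A -> Trpos (tensmx X A) = Tr A * Trpos X.
Proof.
move=> /hermsymmx_udiag[V uV [d ->]] /psdmx_diagonalize[W uW [e -> e0]].
rewrite Trpos_tens // Trpos_udiag // Tr_udiag // mulrC mulr_suml.
apply: eq_bigr => i _; rewrite mulr_sumr; apply: eq_bigr => j _.
by rewrite maxr_pMl // mul0r.
Qed.

Lemma Trpos_tens_psdl m n (X : 'M[R[i]]_m) (A : 'M[R[i]]_n) :
  X \is hermsymmx -> psdmx A -> Trpos (tensmx A X) = Tr A * Trpos X.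
Proof.
move=> /hermsymmx_udiag[V uV [d ->]] /psdmx_diagonalize[W uW [e -> e0]].
rewrite Trpos_tens // Trpos_udiag // Tr_udiag // mulr_suml.
apply: eq_bigr => i _; rewrite mulr_sumr; apply: eq_bigr => j _.
by rewrite maxr_pMr // mulr0.
Qed.

Lemma tensmxBl m n p q (A B : 'M[R[i]]_(m, n)) (D : 'M[R[i]]_(p, q)) :
  tensmx (A - B) D = tensmx A D - tensmx B D.
Proof. by apply/matrixP => i j; rewrite !mxE mulrBl. Qed.

Lemma tensmxBr m n p q (D : 'M[R[i]]_(m, n)) (A B : 'M[R[i]]_(p, q)) :
  tensmx D (A - B) = tensmx D A - tensmx D B.
Proof. by apply/matrixP => i j; rewrite !mxE mulrBr. Qed.

Lemma tensmxZl m n p q a (A : 'M[R[i]]_(m, n)) (D : 'M[R[i]]_(p, q)) :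
  tensmx (a *: A) D = a *: tensmx A D.
Proof. by apply/matrixP => i j; rewrite !mxE mulrA. Qed.

Lemma tensmxZr m n p q a (D : 'M[R[i]]_(m, n)) (A : 'M[R[i]]_(p, q)) :
  tensmx D (a *: A) = a *: tensmx D A.
Proof. by apply/matrixP => i j; rewrite !mxE mulrCA. Qed.

(** * Properties of the hockey-stick divergence *)

Lemma hermsymmx_hockey n (g : R) (rho sigma : 'M[R[i]]_n) :
  psdmx rho -> psdmx sigma -> rho - g%:C *: sigma \is hermsymmx.
Proof. by move=> [hr _] [hs _]; rewrite hermsymmxB ?hermsymmxZ. Qed.

Lemma hockeyE n (g : R) (rho sigma : 'M[R[i]]_n) :
  hockey g rho sigma = Trpos (rho - g%:C *: sigma).
Proof. by []. Qed.

Local Opaque hockey.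

Lemma hockey_triangle n (g1 g2 : R) (rho sigma tau : 'M[R[i]]_n) :
  0 <= g1 -> psdmx rho -> psdmx sigma -> psdmx tau ->
  hockey (g1 * g2) rho sigma <= hockey g1 rho tau + g1 * hockey g2 tau sigma.
Proof.
move=> g10 pr ps pt; have hh := hermsymmx_hockey.
rewrite !hockeyE -TrposZ; [|exact: g10|exact: hh].
have -> : rho - (g1 * g2)%:C *: sigma =
    (rho - g1%:C *: tau) + g1%:C *: (tau - g2%:C *: sigma).
  by rewrite scalerBr scalerA -rmorphM addrA subrK.
by apply: TrposD; rewrite ?hermsymmxZ ?hh.
Qed.

(** Each summand splits as
    $p\rho-\gamma_1\gamma_2q\sigma=p(\rho-\gamma_1\sigma)+\gamma_1(p-\gamma_2q)\sigma$; the two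
    resulting sums give the two terms of the bound. *)
Lemma hockey_strong_convex n (I : finType) (g1 g2 : R) (p q : I -> R)
    (rho sigma : I -> 'M[R[i]]_n) :
  0 <= g1 -> (forall x, 0 <= p x) ->
  (forall x, psdmx (rho x)) -> (forall x, psdmx (sigma x)) ->
  hockey (g1 * g2) (\sum_x (p x)%:C *: rho x) (\sum_x (q x)%:C *: sigma x)
  <= \sum_x p x * hockey g1 (rho x) (sigma x)
     + g1 * chockey g2 (fun x => p x * Tr (sigma x))
                       (fun x => q x * Tr (sigma x)).
Proof.
move=> g10 p0 pr ps; have hh := hermsymmx_hockey.
have hs x := psdmx_herm (ps x).
rewrite hockeyE /chockey mulr_sumr.
have -> : \sum_x (p x)%:C *: rho x -
    (g1 * g2)%:C *: \sum_x (q x)%:C *: sigma x =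
    \sum_x (p x)%:C *: (rho x - g1%:C *: sigma x) +
    \sum_x g1%:C *: ((p x - g2 * q x)%:C *: sigma x).
  rewrite scaler_sumr -sumrB -big_split; apply: eq_bigr => x _ /=.
  rewrite scalerBr !scalerA -!rmorphM -addrA; congr (_ + _).
  by rewrite (mulrBr g1) rmorphB scalerBl mulrA (mulrC (p x)) addKr.
apply: le_trans (TrposD _ _) _;
  try by apply: hermsymmx_sum => x; rewrite !hermsymmxZ ?hh.
apply: lerD; (apply: le_trans (Trpos_sum _) _;
    [by move=> x; rewrite !hermsymmxZ ?hh|]);
  apply: ler_sum => x _; rewrite TrposZ ?hermsymmxZ ?hh //.
(* The coefficient $p(x)-\gamma_2q(x)$ can have either sign, so homogeneity is replaced by
   [TrposZ_psd_le], whose maximum is the summand of [chockey]. *)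
by rewrite ler_wpM2l // mulrA -mulrBl TrposZ_psd_le.
Qed.

Lemma hockey_joint_convex n (I : finType) (g : R) (p : I -> R)
    (rho sigma : I -> 'M[R[i]]_n) :
  (forall x, 0 <= p x) ->
  (forall x, psdmx (rho x)) -> (forall x, psdmx (sigma x)) ->
  hockey g (\sum_x (p x)%:C *: rho x) (\sum_x (p x)%:C *: sigma x)
  <= \sum_x p x * hockey g (rho x) (sigma x).
Proof.
move=> p0 pr ps; have hh x := hermsymmx_hockey g (pr x) (ps x).
rewrite !hockeyE scaler_sumr -sumrB.
under eq_bigr do rewrite scalerA mulrC -scalerA -scalerBr.
apply: le_trans (Trpos_sum _) _ => [x|]; first by rewrite hermsymmxZ.
by apply: ler_sum => x _; rewrite TrposZ.
Qed.

(** Presents a fixed argument as a mixture of copies of itself, which turns joint convexity into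
    convexity in one argument. *)
Lemma sum_pdistr n (I : finType) (p : I -> R) (A : 'M[R[i]]_n) :
  pdistr p -> \sum_x (p x)%:C *: A = A.
Proof.
by case=> _ p1; rewrite -scaler_suml -rmorph_sum p1 rmorph1 scale1r.
Qed.

(** Apply [TrposN] to $\rho-\gamma\sigma$, whose negative is $\gamma(\sigma-\gamma^{-1}\rho)$. *)
Lemma hockey_symmetry n (g : R) (rho sigma : 'M[R[i]]_n) :
  0 < g -> psdmx rho -> psdmx sigma ->
  hockey g rho sigma = g * hockey (1 / g) sigma rho + (Tr rho - g * Tr sigma).
Proof.
move=> g0 pr ps; have hh := hermsymmx_hockey.
rewrite !hockeyE -TrposZ ?hh ?(ltW g0) // -TrZ -TrB.
have g1 : g * (1 / g) = 1 by rewrite mulrCA divff ?gt_eqF // mulr1.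
rewrite (TrposN (hh _ g _ _ pr ps)) opprB scalerBr scalerA.
by rewrite -(rmorphM (real_complex R)) g1 rmorph1 scale1r.
Qed.

Lemma hockey_trace_bound n (g : R) (rho sigma tau : 'M[R[i]]_n) :
  0 <= g -> psdmx rho -> psdmx sigma -> psdmx tau -> Tr sigma <= Tr tau ->
  g / 2 * trnorm (tau - sigma) + (Tr rho - g * Tr tau)
  <= hockey g rho sigma + hockey g rho tau.
Proof.
move=> g0 pr ps pt les; have hh := hermsymmx_hockey.
have hts : tau - sigma \is hermsymmx by rewrite hermsymmxB ?psdmx_herm.
have := TrposD (hermsymmxN (hh _ g _ _ pr pt)) (hh _ g _ _ pr ps).
have -> : - (rho - g%:C *: tau) + (rho - g%:C *: sigma) =
    g%:C *: (tau - sigma) by rewrite scalerBr opprB addrA subrK.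
rewrite (TrposZ g0 hts).
rewrite !hockeyE (TrposN (hh _ g _ _ pr pt)) opprB TrB TrZ.
rewrite trnormE // TrB => le1.
(* Expanding the trace norm leaves the slack
   $\frac{\gamma}{2}(\operatorname{Tr}\tau-\operatorname{Tr}\sigma)$, nonnegative by the trace
   hypothesis. *)
have le2 : 0 <= g * (Tr tau - Tr sigma) by rewrite mulr_ge0 // subr_ge0.
lra.
Qed.

(** The triangle argument with intermediate operator $\sigma_1\otimes\rho_2$: each of the two
    differences has a positive semidefinite tensor factor, whose trace comes out. *)
Lemma hockey_subadditive_l m n (g1 g2 : R) (rho1 sigma1 : 'M[R[i]]_m)
    (rho2 sigma2 : 'M[R[i]]_n) :
  0 <= g1 -> psdmx rho1 -> psdmx sigma1 -> psdmx rho2 -> psdmx sigma2 ->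
  hockey (g1 * g2) (tensmx rho1 rho2) (tensmx sigma1 sigma2)
  <= Tr rho2 * hockey g1 rho1 sigma1 + Tr sigma1 * g1 * hockey g2 rho2 sigma2.
Proof.
move=> g10 pr1 ps1 pr2 ps2; have hh := hermsymmx_hockey.
rewrite mulrAC (mulrC _ g1) !hockeyE.
rewrite -(Trpos_tens_psdr (hh _ g1 _ _ pr1 ps1) pr2).
rewrite -(Trpos_tens_psdl (hh _ g2 _ _ pr2 ps2) ps1) -(TrposZ g10); last first.
  by apply: hermsymmx_tens; [apply: psdmx_herm | apply: hh].
have -> : tensmx rho1 rho2 - (g1 * g2)%:C *: tensmx sigma1 sigma2 =
    tensmx (rho1 - g1%:C *: sigma1) rho2 +
    g1%:C *: tensmx sigma1 (rho2 - g2%:C *: sigma2).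
  by rewrite tensmxBl tensmxBr tensmxZl tensmxZr scalerBr scalerA -rmorphM
    addrA subrK.
by apply: TrposD; rewrite ?hermsymmxZ ?hermsymmx_tens ?hh ?psdmx_herm.
Qed.

(** Here the intermediate operator is $\rho_1\otimes\sigma_2$. *)
Lemma hockey_subadditive_r m n (g1 g2 : R) (rho1 sigma1 : 'M[R[i]]_m)
    (rho2 sigma2 : 'M[R[i]]_n) :
  0 <= g1 -> psdmx rho1 -> psdmx sigma1 -> psdmx rho2 -> psdmx sigma2 ->
  hockey (g1 * g2) (tensmx rho1 rho2) (tensmx sigma1 sigma2)
  <= Tr rho1 * hockey g1 rho2 sigma2 + Tr sigma2 * g1 * hockey g2 rho1 sigma1.
Proof.
move=> g10 pr1 ps1 pr2 ps2; have hh := hermsymmx_hockey.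
rewrite [Tr _ * g1 * _]mulrAC (mulrC _ g1) !hockeyE.
rewrite -(Trpos_tens_psdl (hh _ g1 _ _ pr2 ps2) pr1).
rewrite -(Trpos_tens_psdr (hh _ g2 _ _ pr1 ps1) ps2) -(TrposZ g10); last first.
  by apply: hermsymmx_tens; [apply: hh | apply: psdmx_herm].
have -> : tensmx rho1 rho2 - (g1 * g2)%:C *: tensmx sigma1 sigma2 =
    tensmx rho1 (rho2 - g1%:C *: sigma2) +
    g1%:C *: tensmx (rho1 - g2%:C *: sigma1) sigma2.
  by rewrite tensmxBl tensmxBr tensmxZl tensmxZr scalerBr scalerA -rmorphM
    addrA subrK.
by apply: TrposD; rewrite ?hermsymmxZ ?hermsymmx_tens ?hh ?psdmx_herm.
Qed.

(** The difference factors as $(\rho-\gamma\sigma)\otimes\tau$. *)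
Lemma hockey_stable m n (g : R) (rho sigma : 'M[R[i]]_m) (tau : 'M[R[i]]_n) :
  psdmx rho -> psdmx sigma -> psdmx tau ->
  hockey g (tensmx rho tau) (tensmx sigma tau) = Tr tau * hockey g rho sigma.
Proof.
move=> pr ps pt; rewrite !hockeyE -tensmxZl -tensmxBl.
by rewrite Trpos_tens_psdr // hermsymmx_hockey.
Qed.
End TracePositivePart.

Theorem mainTheorem2 (R : realType) :
  (* triangle inequality *)
  (forall (n : nat) (g1 g2 : R) (rho sigma tau : 'M[R[i]]_n),
    1 <= g1 -> 1 <= g2 -> psdmx rho -> psdmx sigma -> psdmx tau ->
    hockey (g1 * g2) rho sigma <= hockey g1 rho tau + g1 * hockey g2 tau sigma)
  /\
  (* strong convexity *)
  (forall (n : nat) (I : finType) (g1 g2 : R) (p q : I -> R)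
      (rho sigma : I -> 'M[R[i]]_n),
    1 <= g1 -> 1 <= g2 -> pdistr p -> pdistr q ->
    (forall x, psdmx (rho x)) -> (forall x, psdmx (sigma x)) ->
    hockey (g1 * g2) (\sum_x (p x)%:C *: rho x) (\sum_x (q x)%:C *: sigma x)
    <= \sum_x p x * hockey g1 (rho x) (sigma x)
       + g1 * chockey g2 (fun x => p x * Tr (sigma x))
                         (fun x => q x * Tr (sigma x)))
  /\
  (* convexity in the first argument *)
  (forall (n : nat) (I : finType) (g : R) (p : I -> R)
      (rho : I -> 'M[R[i]]_n) (sigma : 'M[R[i]]_n),
    1 <= g -> pdistr p -> (forall x, psdmx (rho x)) -> psdmx sigma ->
    hockey g (\sum_x (p x)%:C *: rho x) sigma
    <= \sum_x p x * hockey g (rho x) sigma)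
  /\
  (* convexity in the second argument *)
  (forall (n : nat) (I : finType) (g : R) (p : I -> R)
      (rho : 'M[R[i]]_n) (sigma : I -> 'M[R[i]]_n),
    1 <= g -> pdistr p -> psdmx rho -> (forall x, psdmx (sigma x)) ->
    hockey g rho (\sum_x (p x)%:C *: sigma x)
    <= \sum_x p x * hockey g rho (sigma x))
  /\
  (* joint convexity *)
  (forall (n : nat) (I : finType) (g : R) (p : I -> R)
      (rho sigma : I -> 'M[R[i]]_n),
    1 <= g -> pdistr p ->
    (forall x, psdmx (rho x)) -> (forall x, psdmx (sigma x)) ->
    hockey g (\sum_x (p x)%:C *: rho x) (\sum_x (p x)%:C *: sigma x)
    <= \sum_x p x * hockey g (rho x) (sigma x))
  /\
  (* stability *)
  (forall (n m : nat) (g : R) (rho sigma : 'M[R[i]]_n) (tau : 'M[R[i]]_m),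
    1 <= g -> psdmx rho -> psdmx sigma -> psdmx tau -> tau != 0 ->
    hockey g (tensmx rho tau) (tensmx sigma tau) = Tr tau * hockey g rho sigma)
  /\
  (* subadditivity *)
  (forall (n1 n2 : nat) (g1 g2 : R) (rho1 sigma1 : 'M[R[i]]_n1)
      (rho2 sigma2 : 'M[R[i]]_n2),
    1 <= g1 -> 1 <= g2 ->
    psdmx rho1 -> psdmx sigma1 -> psdmx rho2 -> psdmx sigma2 ->
    hockey (g1 * g2) (tensmx rho1 rho2) (tensmx sigma1 sigma2)
      <= Tr rho2 * hockey g1 rho1 sigma1
         + Tr sigma1 * g1 * hockey g2 rho2 sigma2
    /\
    hockey (g1 * g2) (tensmx rho1 rho2) (tensmx sigma1 sigma2)
      <= Tr rho1 * hockey g1 rho2 sigma2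
         + Tr sigma2 * g1 * hockey g2 rho1 sigma1)
  /\
  (* symmetry *)
  (forall (n : nat) (g : R) (rho sigma : 'M[R[i]]_n),
    1 <= g -> psdmx rho -> psdmx sigma ->
    hockey g rho sigma = g * hockey (1 / g) sigma rho + (Tr rho - g * Tr sigma))
  /\
  (* trace bound; without Tr sigma <= Tr tau it is false *)
  (forall (n : nat) (g : R) (rho sigma tau : 'M[R[i]]_n),
    1 <= g -> psdmx rho -> psdmx sigma -> psdmx tau -> Tr sigma <= Tr tau ->
    g / 2 * trnorm (tau - sigma) + (Tr rho - g * Tr tau)
    <= hockey g rho sigma + hockey g rho tau).
Proof.
have pos (g : R) : 1 <= g -> 0 < g by apply: lt_le_trans.
have nneg (g : R) : 1 <= g -> 0 <= g by move/pos/ltW.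
do !split.
- move=> n g1 g2 rho sigma tau /nneg g10 _; exact: hockey_triangle.
- move=> n I g1 g2 p q rho sigma /nneg g10 _ [p0 _] _; exact: hockey_strong_convex.
- move=> n I g p rho sigma _ dp pr ps.
  rewrite -{1}(sum_pdistr sigma dp); apply: hockey_joint_convex => //.
  by case: dp.
- move=> n I g p rho sigma _ dp pr ps.
  rewrite -{1}(sum_pdistr rho dp); apply: hockey_joint_convex => //.
  by case: dp.
- move=> n I g p rho sigma _ [p0 _]; exact: hockey_joint_convex.
- move=> n m g rho sigma tau _ pr ps pt _; exact: hockey_stable.
- by apply: hockey_subadditive_l => //; apply: nneg.
- by apply: hockey_subadditive_r => //; apply: nneg.
- move=> n g rho sigma /pos g0; exact: hockey_symmetry.
- move=> n g rho sigma tau /nneg g0; exact: hockey_trace_bound.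
Qed.
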